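(* Let $\mathbf e=(e_1,\dots,e_m)\in\mathbb Z^m$ with $\gcd(e_1,\dots,e_m,r)=1$. Let $f\in\mathbb F_{q^r}[\mathbf X;\boldsymbol\theta]$ be a nonzero multivariate Ore polynomial of total degree at most $c$. Then $$\sum_{\gamma\in H}\dim_{\mathbb F_q}\ker\epsilon_{\tilde\gamma}(f)\ \le\ r\,c\,(q-1)^{m-1}.$$
   Context: $\mathbb F_q$ is a finite field with $q$ elements, $\mathbb F_{q^r}$ its extension of degree $r\ge 1$, $\Phi:\mathbb F_{q^r}\to\mathbb F_{q^r}$, $x\mapsto x^q$, and $m\ge1$. The ring $\mathbb F_{q^r}[\mathbf X^{\pm1};\boldsymbol\theta]$ of multivariate Ore Laurent polynomials consists of finite sums $\sum_{\mathbf u\in\mathbb Z^m}a_{\mathbf u}\mathbf X^{\mathbf u}$ ($a_{\mathbf u}\in\mathbb F_{q^r}$, $\mathbf X^{\mathbf u}=X_1^{u_1}\cdots X_m^{u_m}$), where the variables commute with each other and $\mathbf X^{\mathbf u}\cdot a=\Phi^{\mathbf e\cdot\mathbf u}(a)\,\mathbf X^{\mathbf u}$ for $a\in\mathbb F_{q^r}$, with $\mathbf e\cdot\mathbf u=\sum_i e_iu_i$. The subring $\mathbb F_{q^r}[\mathbf X;\boldsymbol\theta]$ consists of the elements involving only nonnegative exponents; the total degree of such an element is the maximum of $u_1+\cdots+u_m$ over monomials $\mathbf X^{\mathbf u}$ appearing with nonzero coefficient. Let $L=\{\mathbf u\in\mathbb Z^m:\mathbf e\cdot\mathbf u\in r\mathbb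 Z\}$ and let $H$ be the set of group homomorphisms $\gamma:L\to\mathbb F_q^\times$. For every $\gamma\in H$ fix a function $\tilde\gamma:\mathbb Z^m\to\mathbb F_{q^r}^\times$ extending $\gamma$ and satisfying the cocycle condition $\tilde\gamma(\mathbf u+\mathbf v)=\tilde\gamma(\mathbf u)\cdot\Phi^{\mathbf e\cdot\mathbf u}(\tilde\gamma(\mathbf v))$ for all $\mathbf u,\mathbf v\in\mathbb Z^m$ (such extensions exist). This gives a ring homomorphism $\epsilon_{\tilde\gamma}:\mathbb F_{q^r}[\mathbf X^{\pm1};\boldsymbol\theta]\to\operatorname{End}_{\mathbb F_q}(\mathbb F_{q^r})$, $\sum a_{\mathbf u}\mathbf X^{\mathbf u}\mapsto\sum a_{\mathbf u}\tilde\gamma(\mathbf u)\Phi^{\mathbf e\cdot\mathbf u}$. *)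

(* Defs.v *)
From HB Require Import structures.
From mathcomp Require Import all_boot all_order all_algebra all_fingroup.
From mathcomp Require Import all_field.
From mathcomp Require Import finmap monalg.
From mathcomp Require Import boolp classical_sets functions cardinality fsbigop.

Set Implicit Arguments.
Unset Strict Implicit.
Unset Printing Implicit Defensive.

Import Order.TTheory GRing.Theory Num.Theory.
(* Gives 'End(E) its ring structure. The product there is the reversed
   composition, so it is used below only for powers of a single map, while
   composites are written with \o. *)
Import FalgLfun.

Local Open Scope ring_scope.

Section Frobenius.
Variables (F : finFieldType) (E : fieldExtType F).

Definition frob : 'End(E) := linfun (fun x : E => x ^+ #|F|).

Lemma frobE x : frob x = x ^+ #|F|.
Proof.
pose f (y : E) := y ^+ #|F|.
have fA : zmod_morphism f.
  rewrite /f => y z.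
  have [p _ pcharFp] := finPcharP F; rewrite (card_pprimeChar pcharFp).
  elim: (logn _ _) => // n IHn; rewrite expnSr !exprM {}IHn.
  by rewrite -(pchar_lalg E) in pcharFp; rewrite -pFrobenius_autE rmorphB.
have fZ : scalable f by move=> a y; rewrite /f exprZn expf_card.
pose fL : {linear E -> E} := HB.pack f (GRing.isZmodMorphism.Build _ _ f fA)
  (GRing.isScalable.Build _ _ _ _ f fZ).
exact: (lfunE fL).
Qed.

Lemma frob_unit : frob \is a GRing.unit.
Proof.
apply/eqP/vspaceP => x; rewrite memv0 memv_ker frobE expf_eq0.
by rewrite (ltnW (finNzRing_gt1 F)).
Qed.

Definition frobz (k : int) : 'End(E) := frob ^ k.

Lemma frobz0 x : frobz 0 x = x.
Proof. by rewrite /frobz expr0z id_lfunE. Qed.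

Lemma frobzD k l x : frobz (k + l) x = frobz k (frobz l x).
Proof. by rewrite /frobz addrC exprzDr ?frob_unit // lfun_mulE. Qed.

Lemma frobzM k : {morph frobz k : x y / x * y}.
Proof.
have posM n : {morph frobz (Posz n) : x y / x * y}.
  elim: n => [|n IHn] x y; first by rewrite !frobz0.
  by rewrite intS !frobzD IHn /frobz !expr1z !frobE exprMn.
have [n [->|->]] : exists n, k = Posz n \/ k = - Posz n.
- by case: k => n; [exists n; left | exists n.+1; right].
- exact: posM.
move=> x y; have K z : frobz (Posz n) (frobz (- Posz n) z) = z.
  by rewrite -frobzD subrr frobz0.
by rewrite -[in LHS](K x) -[in LHS](K y) -posM -frobzD addNr frobz0.
Qed.

Lemma frobz_inj k : injective (frobz k).
Proof.
by apply: (can_inj (g := frobz (- k))) => x; rewrite -frobzD addNr frobz0.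
Qed.

Lemma frobz1 k : frobz k 1 = 1.
Proof.
have f0 : frobz k 1 != 0.
  by rewrite -(linear0 (frobz k)) (inj_eq (@frobz_inj k)) oner_neq0.
by apply: (mulfI f0); rewrite -frobzM !mulr1.
Qed.

End Frobenius.

Definition edot m (e u : 'rV[int]_m) : int := \sum_(i < m) e 0 i * u 0 i.

Lemma edotD m (e u v : 'rV[int]_m) : edot e (u + v) = edot e u + edot e v.
Proof.
by rewrite -big_split; apply: eq_bigr => i _; rewrite mxE mulrDr.
Qed.

Lemma edotB m (e u v : 'rV[int]_m) : edot e (u - v) = edot e u - edot e v.
Proof.
by rewrite -sumrB; apply: eq_bigr => i _; rewrite !mxE mulrBr.
Qed.

Lemma edot0 m (e : 'rV[int]_m) : edot e 0 = 0.
Proof. by rewrite -(subrr e) edotB subrr. Qed.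

(* The monomial a X^u is << a *g u >>, and the coefficient of f at X^u is
   f@_u. The vector e only matters for the product defined below. *)
Definition ore_laurent (F : finFieldType) (E : fieldExtType F) m
  (e : 'rV[int]_m) : Type := {malg E['rV[int]_m]}.

HB.instance Definition _ (F : finFieldType) (E : fieldExtType F) m
    (e : 'rV[int]_m) :=
  GRing.Zmodule.copy (ore_laurent E e) {malg E['rV[int]_m]}.

Section OreLaurent.
Variables (F : finFieldType) (E : fieldExtType F) (m : nat) (e : 'rV[int]_m).
Implicit Types (f g h : ore_laurent E e) (u v : 'rV[int]_m) (a b : E).

Definition oreU a u : ore_laurent E e := << a *g u >>.

Definition ore_one : ore_laurent E e := oreU 1 0.

(* (a X^u) (b X^v) = a Phi^(e.u)(b) X^(u+v), extended biadditively. *)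
Definition ore_mul f g : ore_laurent E e :=
  \sum_(u <- msupp f) \sum_(v <- msupp g)
    oreU (f@_u * frobz E (edot e u) g@_v) (u + v).

Lemma oreU0 u : oreU 0 u = 0. Proof. exact: monalgU0. Qed.

Lemma oreUD a b u : oreU (a + b) u = oreU a u + oreU b u.
Proof. exact: monalgUD. Qed.

Lemma oreE f : f = \sum_(u <- msupp f) oreU f@_u u.
Proof. exact: monalgE. Qed.

Lemma ore_mulw (d1 d2 : {fset 'rV[int]_m}) f g :
  (msupp f `<=` d1)%fset -> (msupp g `<=` d2)%fset ->
  ore_mul f g = \sum_(u <- d1) \sum_(v <- d2)
    oreU (f@_u * frobz E (edot e u) g@_v) (u + v).
Proof.
move=> le_d1 le_d2; rewrite /ore_mul (big_fset_incl _ le_d1) /=.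
  apply: eq_bigr => u _; apply: big_fset_incl => // v _ /mcoeff_outdom ->.
  by rewrite linear0 mulr0 oreU0.
move=> u _ /mcoeff_outdom fu.
by rewrite big1 => // v _; rewrite fu mul0r oreU0.
Qed.

Lemma ore_mulDl : left_distributive ore_mul +%R.
Proof.
move=> f1 f2 g.
rewrite (ore_mulw (msuppD_le f1 f2) (fsubset_refl _)).
rewrite (ore_mulw (fsubsetUl _ (msupp f2)) (fsubset_refl (msupp g))).
rewrite (ore_mulw (fsubsetUr (msupp f1) _) (fsubset_refl (msupp g))).
rewrite -big_split /=; apply: eq_bigr => u _.
rewrite -big_split /=; apply: eq_bigr => v _.
by rewrite mcoeffD mulrDl oreUD.
Qed.

Lemma ore_mulDr : right_distributive ore_mul +%R.
Proof.
move=> f g1 g2.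
rewrite (ore_mulw (fsubset_refl _) (msuppD_le g1 g2)).
rewrite (ore_mulw (fsubset_refl (msupp f)) (fsubsetUl _ (msupp g2))).
rewrite (ore_mulw (fsubset_refl (msupp f)) (fsubsetUr (msupp g1) _)).
rewrite -big_split /=; apply: eq_bigr => u _.
rewrite -big_split /=; apply: eq_bigr => v _.
by rewrite mcoeffD linearD mulrDr oreUD.
Qed.

Lemma ore_mul0 : left_zero 0 ore_mul.
Proof. by move=> g; rewrite /ore_mul msupp0 big_seq_fset0. Qed.

Lemma ore_mulr0 : right_zero 0 ore_mul.
Proof.
by move=> g; rewrite /ore_mul; apply: big1 => u _; rewrite msupp0 big_seq_fset0.
Qed.

Lemma ore_mulUU a b u v :
  ore_mul (oreU a u) (oreU b v) = oreU (a * frobz E (edot e u) b) (u + v).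
Proof.
by rewrite (ore_mulw (msuppU_le (x := a)) (msuppU_le (x := b)))
  !big_seq_fset1 !mcoeffUU.
Qed.

Lemma ore_suml (I : Type) (s : seq I) (G : I -> ore_laurent E e) g :
  ore_mul (\sum_(i <- s) G i) g = \sum_(i <- s) ore_mul (G i) g.
Proof.
exact: (big_morph (ore_mul^~ g) (fun _ _ => ore_mulDl _ _ _) (ore_mul0 g)).
Qed.

Lemma ore_sumr (I : Type) (s : seq I) (G : I -> ore_laurent E e) g :
  ore_mul g (\sum_(i <- s) G i) = \sum_(i <- s) ore_mul g (G i).
Proof.
exact: (big_morph (ore_mul g) (fun _ _ => ore_mulDr _ _ _) (ore_mulr0 g)).
Qed.

Lemma ore_mulA : associative ore_mul.
Proof.
move=> f g h; rewrite [f]oreE [g]oreE [h]oreE.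
rewrite !ore_suml; apply: eq_bigr => u _.
rewrite ore_sumr [X in _ = ore_mul X _]ore_sumr ore_suml; apply: eq_bigr => v _.
rewrite !ore_sumr; apply: eq_bigr => w _.
by rewrite !ore_mulUU edotD frobzD frobzM mulrA addrA.
Qed.

Lemma ore_mul1 : left_id ore_one ore_mul.
Proof.
move=> f; rewrite [f]oreE ore_sumr; apply: eq_bigr => u _.
by rewrite ore_mulUU edot0 frobz0 mul1r add0r.
Qed.

Lemma ore_mulr1 : right_id ore_one ore_mul.
Proof.
move=> f; rewrite [f]oreE ore_suml; apply: eq_bigr => u _.
by rewrite ore_mulUU frobz1 mulr1 addr0.
Qed.

Lemma ore_one_neq0 : ore_one != 0.
Proof. by rewrite monalgU_eq0 oner_eq0. Qed.

HB.instance Definition _ := GRing.Zmodule_isNzRing.Build (ore_laurent E e)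
  ore_mulA ore_mul1 ore_mulr1 ore_mulDl ore_mulDr ore_one_neq0.

Definition ore_poly : {pred ore_laurent E e} :=
  fun f => all (fun u => [forall i, 0 <= u 0 i]) (msupp f).

Lemma ore_polyP f :
  reflect (forall u, f@_u != 0 -> forall i, 0 <= u 0 i) (f \in ore_poly).
Proof.
apply: (iffP allP) => [fP u|fP u uf].
  by rewrite mcoeff_neq0 => /fP/forallP.
by apply/forallP; apply: fP; rewrite mcoeff_neq0.
Qed.

Fact ore_poly_zmod : zmod_closed ore_poly.
Proof.
split=> [|f g /ore_polyP fP /ore_polyP gP].
  by apply/ore_polyP => u; rewrite mcoeff0 eqxx.
apply/ore_polyP => u; rewrite mcoeffB => fgu.
have [fu|/fP//] := eqVneq f@_u 0.
by apply: gP; move: fgu; rewrite fu sub0r oppr_eq0.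
Qed.

HB.instance Definition _ :=
  GRing.isZmodClosed.Build (ore_laurent E e) ore_poly ore_poly_zmod.

Lemma ore_polyU a u : (forall i, 0 <= u 0 i) -> oreU a u \in ore_poly.
Proof.
move=> u0; apply/ore_polyP => v; rewrite mcoeffU.
by case: (eqVneq u v) => [<-|] //; rewrite mulr0n eqxx.
Qed.

Fact ore_poly_subring : subring_closed ore_poly.
Proof.
split=> [|f g|f g /ore_polyP fP /ore_polyP gP]; last 1 first.
- rewrite [_ * _]/(ore_mul f g) /ore_mul !big_seq.
  apply: rpred_sum => u uf; rewrite big_seq; apply: rpred_sum => v vg.
  apply: ore_polyU => i; rewrite mxE addr_ge0 //.
    by apply: fP; rewrite mcoeff_neq0.
  by apply: gP; rewrite mcoeff_neq0.
- by apply: ore_polyU => i; rewrite mxE.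
- exact: rpredB.
Qed.

HB.instance Definition _ := GRing.isMulClosed.Build (ore_laurent E e) ore_poly
  (GRing.subring_closedM ore_poly_subring).

(* The exponents of an element of ore_poly are nonnegative, so that the absolute
   value is then only a cast to nat. *)
Definition ore_tdeg f : nat := \max_(u <- msupp f) `|(\sum_(i < m) u 0 i)%R|%N.

(* A ring morphism when gt is a cocycle: see ore_eval1 and ore_evalM. *)
Definition ore_eval (gt : 'rV[int]_m -> E) f : 'End(E) :=
  \sum_(u <- msupp f) (amull (f@_u * gt u) \o frobz E (edot e u))%VF.

End OreLaurent.

Arguments ore_poly {F} E {m} e.

Section LatticeCharacters.
Variables (F : finFieldType) (E : fieldExtType F) (m : nat) (e : 'rV[int]_m).
Variable r : nat.

Definition in_lattice : {pred 'rV[int]_m} := fun u => (r%:Z %| edot e u)%Z.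

Fact in_lattice_zmod : zmod_closed in_lattice.
Proof.
split=> [|u v ur vr]; first by rewrite unfold_in edot0 dvdz0.
rewrite -[_ \in _]/(edot e (u - v) \in dvdz r) edotB.
have H1 : edot e u \in dvdz r := ur.
have H2 : edot e v \in dvdz r := vr.
exact: rpredB.
Qed.

HB.instance Definition _ :=
  GRing.isZmodClosed.Build 'rV[int]_m in_lattice in_lattice_zmod.

(* The subgroup L of Z^m of the vectors u such that r divides e.u. *)
Record lattice := Lattice { lattice_val :> 'rV[int]_m;
                            lattice_valP : lattice_val \in in_lattice }.

HB.instance Definition _ := [isSub for lattice_val].
HB.instance Definition _ := [Choice of lattice by <:].
HB.instance Definition _ := [SubChoice_isSubZmodule of lattice by <:].

Definition lattice_chars : set (lattice -> {unit F}) :=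
  [set g | forall u v : lattice, g (u + v) = (g u * g v)%g]%classic.

Definition cocycle_extension (g : lattice -> {unit F})
    (gt : 'rV[int]_m -> E) : Prop :=
  [/\ forall u, gt u != 0,
      forall u : lattice, gt (val u) = (val (g u))%:A
    & forall u v, gt (u + v) = gt u * frobz E (edot e u) (gt v)].

End LatticeCharacters.

Arguments lattice_chars F {m} e r.

Section LatticeCharsFinite.
Variables (F : finFieldType) (m r : nat) (e : 'rV[int]_m).

(* Ensures that a sum over (g \in lattice_chars F e r) is a genuine finite sum,
   not the default value that fsbigop gives to sums with infinite support. *)
Lemma lattice_chars_finite : (0 < r)%N ->
  finite_set (lattice_chars F e r).
Proof.
move=> r0; pose L := lattice e r.
pose V (s : 'I_m + {ffun 'I_m -> 'I_r}) : 'rV[int]_m :=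
  match s with inl i => r%:Z *: delta_mx 0 i | inr w => \row_i (w i)%:Z end.
pose R (g : L -> {unit F}) := [ffun s => g (insubd (0 : L) (V s))].
suff injR : {in lattice_chars F e r &, injective R}.
  by rewrite -(eq_finite_set (inj_card_eq injR)).
move=> g1 g2 /set_mem/= g1M /set_mem/= g2M /ffunP eqR.
have g0 (g : L -> {unit F}) : {morph g : u v / u + v >-> (u * v)%g} -> g 0 = 1%g.
  by move=> gM; apply: (mulgI (g 0)); rewrite -gM addr0 mulg1.
have gN (g : L -> {unit F}) : {morph g : u v / u + v >-> (u * v)%g} ->
    forall u, g (- u) = (g u)^-1%g.
  by move=> gM u; apply: (mulgI (g u)); rewrite -gM subrr mulgV g0.
pose K : {pred L} := fun u => g1 u == g2 u.
have K_zmod : zmod_closed K.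
  split=> [|u v]; rewrite !unfold_in /K ?(g0 _ g1M) ?(g0 _ g2M) //.
  by move=> /eqP gu /eqP gv; rewrite g1M g2M !gN // gu gv.
pose KZ := HB.pack_for (zmodClosed L) K (GRing.isZmodClosed.Build L K K_zmod).
have KV s : V s \in in_lattice e r -> insubd (0 : L) (V s) \in KZ.
  by move=> _; have := eqR s; rewrite !ffunE => gs; apply/eqP.
have Ldelta i : V (inl i) \in in_lattice e r.
  rewrite -[_ \in _]/(edot e (r%:Z *: delta_mx 0 i) \in dvdz r) /edot.
  by apply: rpred_sum => j _; rewrite !mxE mulrCA dvdz_mulr.
pose w (u : 'rV[int]_m) i : 'I_r := Ordinal (ltn_pmod `|(u ord0 i %% r)%Z|%N r0).
have wE (u : 'rV[int]_m) i : (w u i)%:Z = (u ord0 i %% r)%Z.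
  have rn0 : r%:Z != 0 by rewrite -lt0n.
  have lt_mod : (`|(u ord0 i %% r)%Z| < r)%N.
    by rewrite -ltz_nat gez0_abs ?modz_ge0 ?ltz_pmod.
  by rewrite /= modn_small // gez0_abs ?modz_ge0.
pose d i : L := Lattice (Ldelta i).
have dK i : d i \in KZ.
  have := KV (inl i) (Ldelta i).
  by rewrite (_ : insubd _ _ = d i) // -[V _]/(val (d i)) valKd.
apply/funext => u; apply/eqP; rewrite -[_ == _]/(u \in KZ).
pose s := \sum_i d i *~ (val u ord0 i %/ r)%Z.
have sK : s \in KZ by apply: rpred_sum => i _; apply: rpredMz.
have dE j z i : val (d j *~ z) 0 i = z * r%:Z * (i == j)%:R.
  by rewrite raddfMz -scaler_int !mxE eqxx intz mulrA.
have us : val (u - s) = V (inr [ffun i => w (val u) i]).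
  apply/rowP => i; rewrite raddfB raddf_sum !mxE summxE.
  rewrite (bigD1 i) //= big1 => [|j ji]; last by rewrite dE eq_sym (negPf ji) mulr0.
  rewrite dE eqxx mulr1 addr0 ffunE wE.
  by rewrite {1}(divz_eq (val u ord0 i) r) addrC addKr.
rewrite -(subrK s u) rpredD //.
by have := KV (inr [ffun i => w (val u) i]); rewrite -us valKd; apply; apply: valP.
Qed.
End LatticeCharsFinite.

Section EvaluationMorphism.
Variables (F : finFieldType) (E : fieldExtType F) (m r : nat).
Variables (e : 'rV[int]_m) (gam : lattice e r -> {unit F}).
Variables (gt : 'rV[int]_m -> E) (gtP : cocycle_extension gam gt).
Implicit Types (f g : ore_laurent E e).

Lemma ore_evalw (d : {fset 'rV[int]_m}) f : (msupp f `<=` d)%fset ->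
  ore_eval gt f = \sum_(u <- d) (amull (f@_u * gt u) \o frobz E (edot e u))%VF.
Proof.
move=> fd; apply: big_fset_incl => // u _ /mcoeff_outdom ->.
by rewrite mul0r linear0 comp_lfun0l.
Qed.

Lemma ore_eval_zmod : zmod_morphism (ore_eval gt : ore_laurent E e -> _).
Proof.
move=> f g; rewrite (ore_evalw (msuppB_le f g)).
rewrite (ore_evalw (fsubsetUl (msupp f) (msupp g))).
rewrite (ore_evalw (fsubsetUr (msupp f) (msupp g))).
rewrite -sumrB; apply: eq_bigr => u _.
by rewrite mcoeffB mulrBl linearB comp_lfunDl comp_lfunNl.
Qed.

HB.instance Definition _ :=
  GRing.isZmodMorphism.Build (ore_laurent E e) 'End(E) (ore_eval gt) ore_eval_zmod.

Lemma ore_evalU a u : ore_eval gt (oreU e a u)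
  = (amull (a * gt u) \o frobz E (edot e u))%VF.
Proof.
by rewrite (ore_evalw (msuppU_le (x := a))) big_seq_fset1 mcoeffUU.
Qed.

Lemma ore_eval1 : ore_eval gt (1 : ore_laurent E e) = \1%VF.
Proof.
have [gt0 _ gtD] := gtP.
have gt01 : gt 0 = 1.
  apply: (mulfI (gt0 0)); rewrite mulr1.
  by rewrite -[in RHS](addr0 (0 : 'rV_m)) gtD edot0 frobz0.
rewrite -[1]/(oreU e 1 0) ore_evalU gt01 mul1r edot0.
by apply/lfunP => x; rewrite comp_lfunE frobz0 !lfunE /= mul1r.
Qed.

Lemma ore_evalM f g : ore_eval gt (f * g) = (ore_eval gt f \o ore_eval gt g)%VF.
Proof.
have [_ _ gtD] := gtP.
rewrite -[f * g]/(ore_mul f g) [f]oreE [g]oreE ore_suml !raddf_sum.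
rewrite (big_morph (fun h => h \o _)%VF (fun _ _ => comp_lfunDl _ _ _) (comp_lfun0l _ _)).
apply: eq_bigr => u _; rewrite ore_sumr raddf_sum.
rewrite (big_morph (fun h => _ \o h)%VF (fun _ _ => comp_lfunDr _ _ _) (comp_lfun0r _ _)).
apply: eq_bigr => v _; rewrite ore_mulUU /= !ore_evalU.
apply/lfunP => x; rewrite !comp_lfunE !lfunE /= edotD frobzD gtD !frobzM.
by rewrite !mulrA; congr (_ * _); rewrite -!mulrA; congr (_ * _); rewrite mulrCA.
Qed.

End EvaluationMorphism.

(* Main.v *)
(** Put n = q - 1.  Every x in the kernel of the evaluation of f at gamma gives
    a function phi(s) = gt(s) Phi^(e.s)(x) on Z^m.  Letting x run through bases
    of the kernels, these functions are linearly independent over E: Artin's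
    independence of characters on L separates the gamma's, and a Moore
    determinant argument treats each kernel.  They are periodic modulo n L, and
    the relation (X^v f)(x) = 0 is a linear recurrence
      sum_w Phi^(e.v)(f_w) phi(v + w) = 0.
    Let X^u be the leading monomial of f for a weight on exponents, and choose
    in each class modulo n L a nonnegative representative of least weight.  By
    the recurrence a solution is determined by its values at the representatives
    that are not >= u.  Such a representative s has s_i = j for some i and some
    j < u_i, and there are at most r n^(m-1) classes meeting a given hyperplane
    s_i = j, so the number of independent solutions is at most
    (sum_i u_i) r n^(m-1) <= r c n^(m-1). *)

Require Import Defs.
From HB Require Import structures.
From mathcomp Require Import all_boot all_order all_algebra all_fingroup.
From mathcomp Require Import cyclic all_field.
From mathcomp Require Import finmap monalg.
From mathcomp Require Import boolp classical_sets functions cardinality fsbigop.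

Set Implicit Arguments.
Unset Strict Implicit.
Unset Printing Implicit Defensive.

Import Order.TTheory GRing.Theory Num.Theory.
Local Open Scope ring_scope.

(** * Independence of characters, a rank bound, digits and counting *)

Lemma characters_free (T : Type) (op : T -> T -> T) (x0 : T) (K : fieldType)
    (I : eqType) (chi : I -> T -> K)
    (chiM : forall i x y, chi i (op x y) = chi i x * chi i y)
    (chi_neq0 : forall i x, chi i x != 0)
    (chi_inj : forall i j, chi i =1 chi j -> i = j)
    (s : seq I) (a : I -> K) :
  uniq s -> (forall x, \sum_(i <- s) a i * chi i x = 0) ->
  {in s, forall i, a i = 0}.
Proof.
elim: s a => [|i0 s IHs] a //= /andP[i0s s_uniq] sum0.
have as0 : {in s, forall i, a i = 0}.
  move=> i si; have [//|ai] := eqVneq (a i) 0.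
  suff ii0 : i = i0 by rewrite -ii0 si in i0s.
  apply: chi_inj => y; apply/eqP; rewrite -subr_eq0; apply/eqP.
  apply: (mulfI ai); rewrite mulr0.
  (* Artin's trick: the relation translated by y minus [chi i0 y] times the relation no longer
     involves [i0]. *)
  apply: (IHs (fun i => a i * (chi i y - chi i0 y))) => // x.
  transitivity (\sum_(i <- i0 :: s) a i * chi i (op y x)
                - chi i0 y * \sum_(i <- i0 :: s) a i * chi i x); last first.
    by rewrite !sum0 mulr0 subr0.
  rewrite mulr_sumr -sumrB big_cons [X in _ = X + _](_ : _ = 0) ?add0r.
    apply: eq_bigr => j _.
    by rewrite chiM mulrBr mulrBl !mulrA [chi i0 y * _]mulrC.
  by rewrite chiM mulrCA subrr.
move=> i; rewrite inE => /predU1P[->|/as0//].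
have /eqP := sum0 x0; rewrite big_cons big_seq big1 => [|j /as0->]; last first.
  by rewrite mul0r.
by rewrite addr0 mulf_eq0 (negPf (chi_neq0 _ _)) orbF => /eqP.
Qed.

(** The values form a matrix with independent rows, whose rank is at most its number of columns. *)
Lemma free_card_le (K : fieldType) (I J : finType) (B : {set J})
    (psi : I -> J -> K) :
  (forall b : I -> K, {in B, forall j, \sum_i b i * psi i j = 0} ->
     forall i, b i = 0) ->
  (#|I| <= #|B|)%N.
Proof.
move=> psi_free.
pose M := \matrix_(i < #|I|, j < #|B|) psi (enum_val i) (enum_val j).
suff /eqP <- : row_free M by apply: rank_leq_col.
apply: inj_row_free => v vM; apply/rowP => i; rewrite mxE -(enum_valK i).
apply: (psi_free (fun i => v 0 (enum_rank i))) => j Bj.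
have /rowP/(_ (enum_rank_in Bj j)) := vM; rewrite !mxE; apply: etrans.
rewrite (reindex _ (onW_bij _ (enum_val_bij I))) /=.
by apply: eq_bigr => k _; rewrite mxE enum_valK enum_rankK_in.
Qed.

Lemma sum_sigT (V : nmodType) (I : finType) (J : I -> finType)
    (G : {i : I & J i} -> V) :
  \sum_p G p = \sum_i \sum_(j : J i) G (Tagged J j).
Proof.
rewrite (@sig_big_dep _ _ _ I J xpredT (fun=> xpredT) (fun i j => G (Tagged J j))).
by apply: eq_bigr => -[].
Qed.

(** Uniqueness of digits, which will rule out ties between weights of monomials. *)
Lemma base_expansion_inj B m (u v : 'I_m -> nat) :
    (forall i, u i < B)%N -> (forall i, v i < B)%N ->
  (\sum_i u i * B ^ i = \sum_i v i * B ^ i)%N -> u =1 v.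
Proof.
elim: m u v => [|m IHm] u v uB vB; first by move=> _ [].
rewrite !big_ord_recl !muln1.
have shift (w : 'I_m.+1 -> nat) : (\sum_(i < m) w (lift ord0 i) * B ^ bump 0 i
    = (\sum_(i < m) w (lift ord0 i) * B ^ i) * B)%N.
  by rewrite big_distrl; apply: eq_bigr => i _; rewrite /= expnSr mulnA.
rewrite !shift => eq_uv; have B0 := leq_ltn_trans (leq0n _) (uB ord0).
have uv0 : u ord0 = v ord0.
  by have /(congr1 (modn^~ B)) := eq_uv; 
    rewrite addnC modnMDl addnC modnMDl !modn_small.
move: eq_uv; rewrite uv0 => /addnI/eqP; rewrite eqn_pmul2r // => /eqP eq_uv i.
have [j ->|->//] := unliftP ord0 i.
exact: (IHm (fun k => u (lift ord0 k)) (fun k => v (lift ord0 k))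
  (fun=> uB _) (fun=> vB _) eq_uv).
Qed.

Lemma card_ffun_fixed m n (i : 'I_m) (a : 'I_n) :
  #|[set g : {ffun 'I_m -> 'I_n} | g i == a]| = (n ^ m.-1)%N.
Proof.
pose P j : pred 'I_n := if j == i then pred1 a else predT.
rewrite (_ : #|_| = #|family P|); last first.
  apply: eq_card => g; rewrite inE; apply/eqP/familyP => [ga j|/(_ i)].
    by rewrite /P; case: eqP => // ->; rewrite inE ga.
  by rewrite /P eqxx => /eqP.
rewrite card_family foldrE big_map big_enum /= (bigD1 i) //= /P eqxx card1 mul1n.
rewrite (eq_bigr (fun _ => n)) => [|j /negPf->]; last by rewrite card_ord.
by rewrite prod_nat_const cardC1 card_ord.
Qed.

(** * Powers of Frobenius and Moore's independence argument *)

Section FrobeniusPowers.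
Import FalgLfun.
Variables (F : finFieldType) (E : fieldExtType F).

Lemma frobz_fixed (x : E) : frobz E 1 x = x -> exists a : F, x = a%:A.
Proof.
rewrite /frobz expr1z frobE => x_fixed.
have : x \in (1%AS : {subfield E}).
  by rewrite Fermat's_little_theorem dimv1 expn1 x_fixed.
by move/vlineP.
Qed.

Lemma frobz_dim k x : frobz E ((\dim {:E})%:Z * k) x = x.
Proof.
have frob_iter n y : frobz E n%:Z y = y ^+ (#|F| ^ n).
  elim: n => [|n IHn]; first by rewrite frobz0.
  by rewrite intS frobzD IHn /frobz expr1z frobE -exprM expnSr.
have -> : frobz E ((\dim {:E})%:Z * k) = \1%VF.
  rewrite /frobz -exprz_exp -/(frobz E _) (_ : frobz E _ = 1) ?exp1rz //.
  apply/lfunP => y; rewrite frob_iter id_lfunE; apply/eqP.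
  by rewrite -Fermat's_little_theorem memvf.
by rewrite id_lfunE.
Qed.

Lemma frobz_eqmod k l x : (k = l %[mod \dim {:E}])%Z ->
  frobz E k x = frobz E l x.
Proof.
move/eqP; rewrite eqz_mod_dvd => /dvdzP[d kl].
by rewrite -(subrK l k) addrC kl mulrC frobzD frobz_dim.
Qed.

(* The Moore determinant argument: normalise the first coefficient of a relation
   to 1 and subtract its Frobenius twist, which leaves a shorter relation. *)
Lemma moore_free (s : seq E) (b : nat -> E) :
  free s -> (forall k, \sum_(i < size s) b i * frobz E k s`_i = 0) ->
  forall i, (i < size s)%N -> b i = 0.
Proof.
elim: s b => [|x s IHs] b //=; rewrite free_cons => /andP[xs s_free] sum0.
have b0 : b 0%N = 0.
  have [//|b0] := eqVneq (b 0%N) 0.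
  pose d i := b i / b 0%N.
  have sumd k : frobz E k x + \sum_(i < size s) d i.+1 * frobz E k s`_i = 0.
    have /(congr1 ( *%R (b 0%N)^-1)) := sum0 k.
    rewrite mulr0 big_ord_recl mulrDr mulKf // mulr_sumr => sum0k.
    rewrite -[RHS]sum0k; congr (_ + _).
    by apply: eq_bigr => i _; rewrite mulrA [d _]mulrC.
  have d_fixed i : (i < size s)%N -> frobz E 1 (d i.+1) = d i.+1.
    move=> si; apply/eqP; rewrite -subr_eq0; apply/eqP.
    apply: (IHs (fun j => frobz E 1 (d j.+1) - d j.+1)) => // k.
    transitivity (frobz E 1 (frobz E (k - 1) x
        + \sum_(j < size s) d j.+1 * frobz E (k - 1) s`_j)
      - (frobz E k x + \sum_(j < size s) d j.+1 * frobz E k s`_j)); last first.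
      by rewrite !sumd linear0 subr0.
    have frob1 y : frobz E 1 (frobz E (k - 1) y) = frobz E k y.
      by rewrite -frobzD addrC subrK.
    rewrite linearD linear_sum [X in X + _ - _]frob1 opprD addrACA subrr add0r.
    rewrite -sumrB; apply: eq_bigr => j _.
    by rewrite [X in _ = X - _]frobzM frob1 mulrBl.
  (* The [d i.+1] are fixed by Frobenius, hence scalars from F, so the relation at k = 0 puts x in
     the span of s. *)
  case/negP: xs; have /eqP := sumd 0; rewrite frobz0 addr_eq0 => /eqP->.
  rewrite rpredN; apply: rpred_sum => i _; rewrite frobz0.
  have [a ->] := frobz_fixed (d_fixed _ (ltn_ord i)).
  by rewrite mulr_algl rpredZ // memv_span ?mem_nth.
case=> [//|i] si; apply: (IHs (fun j => b j.+1)) => // k.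
by have := sum0 k; rewrite big_ord_recl b0 mul0r add0r.
Qed.

End FrobeniusPowers.

(** * Exponents modulo r and modulo n L *)

Lemma edotZ m (e u : 'rV[int]_m) a : edot e (a *: u) = a * edot e u.
Proof.
by rewrite /edot mulr_sumr; apply: eq_bigr => i _; rewrite mxE mulrCA.
Qed.

(** By Bezout the gcd of the entries of e is a value of [edot e], and it is invertible modulo r.
    Hence every power of Frobenius occurs as some Phi^(e.s). *)
Lemma edot_surj m (e : 'rV[int]_m) r :
    gcdn (\big[gcdn/0%N]_(i < m) `|e 0%R i|%N) r = 1%N ->
  forall k, exists s, (edot e s = k %[mod r])%Z.
Proof.
set g := \big[_/_]_(i < m) _ => g_r k.
have [s sE] : exists s, edot e s = g%:Z.
  apply: (big_ind (fun d : nat => exists s, edot e s = d%:Z)).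
  - by exists 0; rewrite edot0.
  - move=> x y [s sx] [t ty]; have [a [b ab]] := Bezoutz x y.
    by exists (a *: s + b *: t); rewrite edotD !edotZ sx ty ab.
  move=> i _; exists (sgz (e 0 i) *: delta_mx 0 i).
  rewrite edotZ /edot (bigD1 i) //= big1 => [|j /negPf ji]; last first.
    by rewrite mxE ji andbF mulr0.
  by rewrite mxE !eqxx mulr1 addr0 abszEsg.
have [a [b ab]] := Bezoutz g r; exists (k * a *: s).
have abE : a * g%:Z = 1 - b * r%:Z 
  by apply/eqP; rewrite eq_sym subr_eq eq_sym ab /gcdz !absz_nat g_r.
apply/eqP; rewrite edotZ sE eqz_mod_dvd -mulrA abE mulrBr mulr1 addrAC subrr.
by rewrite add0r mulrA -mulNr dvdz_mull.
Qed.

(** The outer natural remainder changes nothing; it supplies the bound required by ['I_n]. *)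
Definition ord_mod n (n_gt0 : (0 < n)%N) (x : int) : 'I_n :=
  Ordinal (ltn_pmod `|(x %% n)%Z| n_gt0).

Lemma ord_mod_eq n (n_gt0 : (0 < n)%N) x y :
  ord_mod n_gt0 x = ord_mod n_gt0 y -> (x = y %[mod n])%Z.
Proof.
have ordE z : (ord_mod n_gt0 z)%:Z = (z %% n)%Z.
  have n_neq0 : n%:Z != 0 by rewrite -lt0n.
  have lt_mod : (`|(z %% n)%Z| < n)%N.
    by rewrite -ltz_nat gez0_abs ?modz_ge0 ?ltz_pmod.
  by rewrite /= modn_small // gez0_abs ?modz_ge0.
by move=> xy; rewrite -!ordE xy.
Qed.

Section Labels.
Variables (m n r : nat) (n_gt0 : (0 < n)%N) (r_gt0 : (0 < r)%N).
Variable e : 'rV[int]_m.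

Local Notation labels := ({ffun 'I_m -> 'I_n} * 'I_r)%type.

(* Separates the classes of Z^m modulo n L. *)
Definition label (s : 'rV[int]_m) : labels :=
  ([ffun i => ord_mod n_gt0 (s 0 i)],
   ord_mod r_gt0 (edot e (\row_i (s 0%R i %/ n)%Z))).

(** Equal residues make s - t equal to n times the difference of the quotients, which the second
    component places in L. *)
Lemma label_eq s t : label s = label t ->
  exists l : lattice e r, s = n%:Z *: val l + t.
Proof.
move=> st; have /ffunP eq_n : (label s).1 = (label t).1 by rewrite st.
have /ord_mod_eq/eqP : (label s).2 = (label t).2 by rewrite st.
rewrite eqz_mod_dvd -edotB.
set l := _ - _ => l_r; exists (Lattice (l_r : l \in in_lattice e r)).
have shift (a b d : int) : a * n%:Z + d = n%:Z * (a - b) + (b * n%:Z + d).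
  by rewrite mulrBr ![n%:Z * _]mulrC addrA subrK.
apply/rowP => i; have := eq_n i; rewrite !ffunE => /ord_mod_eq st_i.
rewrite !mxE {1}(divz_eq (s 0 i) n) {2}(divz_eq (t 0 i) n) st_i.
exact: shift.
Qed.

Lemma card_label_fixed (i : 'I_m) (a : 'I_n) :
  #|[set k : labels | k.1 i == a]| = (r * n ^ m.-1)%N.
Proof.
rewrite -(card_ffun_fixed i a) -[X in (X * _)%N]card_ord -cardsT mulnC -cardsX.
by apply: eq_card => k; rewrite !inE andbT.
Qed.

(** A union bound over the hyperplanes s_i = j; a value j >= n only repeats an earlier one. *)
Lemma card_label_box (u : 'rV[int]_m) (D : {set labels}) :
    {in D, forall k : labels, exists i (j : 'I_`|u 0%R i|), k.1 i = ord_mod n_gt0 j} ->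
  (#|D| <= (\sum_i `|u 0%R i|) * (r * n ^ m.-1))%N.
Proof.
move=> Dbox.
pose C i (j : 'I_`|u 0 i|) := [set k : labels | k.1 i == ord_mod n_gt0 j].
have DC : D \subset (\bigcup_i \bigcup_j C i j)%SET.
  apply/fintype.subsetP => k /Dbox[i [j kij]].
  by apply/bigcupP; exists i => //; apply/bigcupP; exists j; rewrite ?inE ?kij.
have card_cup (I : finType) (A : I -> {set labels}) N :
    (forall i, #|A i| <= N i)%N -> (#|\bigcup_i A i| <= \sum_i N i)%N.
  move=> AN; elim/big_ind2: _ => // [|X1 N1 X2 N2 le1 le2]; first by rewrite cards0.
  by apply: leq_trans (leq_card_setU _ _) (leq_add le1 le2).
apply: leq_trans (subset_leq_card DC) _.
rewrite big_distrl; apply: (card_cup) => i.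
rewrite -[X in (_ <= X * (_ * _))%N](card_ord `|u 0 i|) -sum_nat_const.
by apply: card_cup => j; rewrite card_label_fixed.
Qed.

End Labels.

(** * Weights of exponents and the leading monomial *)

Definition nonneg_row m (s : 'rV[int]_m) := forall i, 0 <= s 0 i.

Definition weight m B (s : 'rV[int]_m) : nat := (\sum_i `|s 0%R i| * B ^ i)%N.

Lemma weightD m B (s t : 'rV[int]_m) : nonneg_row s -> nonneg_row t ->
  weight B (s + t) = (weight B s + weight B t)%N.
Proof.
move=> s0 t0; rewrite /weight -big_split; apply: eq_bigr => i _ /=.
by rewrite mxE -mulnDl -(gez0_abs (s0 i)) -(gez0_abs (t0 i)) -PoszD !absz_nat.
Qed.

Lemma exists_argmax (T : eqType) (w : T -> nat) (s : seq T) :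
  s != [::] -> exists2 x, x \in s & {in s, forall y, w y <= w x}%N.
Proof.
elim: s => // x [|y s] IHs _.
  by exists x; rewrite ?mem_head // => z; rewrite inE => /eqP->.
have [//|z zs z_max] := IHs.
have [xz|/ltnW zx] := leqP (w x) (w z).
  exists z; first by rewrite inE zs orbT.
  by move=> t; rewrite inE => /predU1P[->|/z_max].
exists x; first exact: mem_head.
by move=> t; rewrite inE => /predU1P[->|/z_max/leq_trans->].
Qed.

Section LeadingExponent.
Variables (F : finFieldType) (E : fieldExtType F) (m c : nat).
Variables (e : 'rV[int]_m) (f : ore_laurent E e).
Hypotheses (f_poly : f \in ore_poly E e) (f_neq0 : f != 0).
Hypothesis f_deg : (ore_tdeg f <= c)%N.

Lemma ore_support_nonneg w : w \in msupp f -> nonneg_row w.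
Proof. by rewrite -mcoeff_neq0; move/ore_polyP: f_poly; apply. Qed.

Lemma ore_support_deg w : w \in msupp f -> (\sum_i `|w 0%R i| <= c)%N.
Proof.
move=> wf; apply: leq_trans f_deg.
have wE : (\sum_i `|w 0%R i|)%N%:Z = \sum_(i < m) w 0 i.
  rewrite (big_morph Posz PoszD (erefl _)); apply: eq_bigr => i _.
  by rewrite gez0_abs //; apply: ore_support_nonneg.
by rewrite /ore_tdeg (bigD1_seq w) -?wE ?fset_uniq //= leq_maxl.
Qed.

(** Entries of exponents in the support are at most c, hence digits in base c + 1: the weight is
    injective there and its maximum is attained once. *)
Lemma leading_exponent : exists2 u, u \in msupp f &
  {in msupp f, forall w, w != u -> weight c.+1 w < weight c.+1 u}%N.
Proof.
have f_supp : enum_fset (msupp f) != [::].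
  apply: contra_neq f_neq0 => f0; rewrite [f]oreE big_seq big1 // => u.
  by rewrite -[_ \in _]/(u \in enum_fset (msupp f)) f0.
have [u uf u_max] := exists_argmax (weight c.+1) f_supp.
exists u => // w wf wu; rewrite ltn_neqAle u_max // andbT.
have lt_c t i : t \in msupp f -> (`|t 0%R i| < c.+1)%N.
  move=> /ore_support_deg; apply: leq_trans.
  by rewrite (bigD1 i) //= leq_addr.
apply: contra_neq wu => /base_expansion_inj eq_wu; apply/rowP => i.
rewrite -(gez0_abs (ore_support_nonneg wf i)).
rewrite -(gez0_abs (ore_support_nonneg uf i)) eq_wu // => j; exact: lt_c.
Qed.

End LeadingExponent.

(** * The linear recurrence and its solutions *)

Section Vanishing.
Variables (F : finFieldType) (E : fieldExtType F) (m n r c : nat).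
Hypotheses (n_gt0 : (0 < n)%N) (r_gt0 : (0 < r)%N).
Variables (e : 'rV[int]_m) (f : ore_laurent E e).
Hypotheses (f_poly : f \in ore_poly E e) (f_neq0 : f != 0).
Hypothesis f_deg : (ore_tdeg f <= c)%N.

Definition ore_annihilated (phi : 'rV[int]_m -> E) := forall v,
  \sum_(w <- msupp f) frobz E (edot e v) f@_w * phi (v + w) = 0.

Definition lattice_periodic (phi : 'rV[int]_m -> E) :=
  forall (l : lattice e r) s, phi (n%:Z *: val l + s) = phi s.

Local Notation lab := (label n_gt0 r_gt0 e).
Local Notation labels := ({ffun 'I_m -> 'I_n} * 'I_r)%type.

Lemma minimal_representatives : exists rep : labels -> 'rV[int]_m,
  forall s, nonneg_row s -> [/\ nonneg_row (rep (lab s)), lab (rep (lab s)) = lab s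
    & (weight c.+1 (rep (lab s)) <= weight c.+1 s)%N].
Proof.
suff /choice[rep repP] : forall k, exists t, forall s, nonneg_row s -> lab s = k ->
    [/\ nonneg_row t, lab t = k & (weight c.+1 t <= weight c.+1 s)%N].
  by exists rep => s s0; apply: repP.
move=> k; pose P j := `[< exists s, [/\ nonneg_row s, lab s = k & weight c.+1 s = j] >].
have [[s [s0 sk]]|no_s] := pselect (exists s, nonneg_row s /\ lab s = k); last first.
  (* A label that no nonnegative exponent has: the claim is vacuous and 0 is a default. *)
  by exists 0 => s s0 sk; case: no_s; exists s.
have exP : exists j, P j by exists (weight c.+1 s); apply/asboolP; exists s.
case: (ex_minnP exP) => j /asboolP[t [t0 tk <-]] j_min.
by exists t => s' s'0 s'k; split => //; apply: j_min; apply/asboolP; exists s'.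
Qed.

(* The recurrence at a multiple X^v X^u of the leading monomial expresses
   phi (v + u) through values of phi at exponents of smaller weight. *)
Lemma ore_annihilated_eq0 : exists (D : {set labels}) (rep : labels -> 'rV[int]_m),
  (#|D| <= r * c * n ^ m.-1)%N /\
  forall phi, lattice_periodic phi -> ore_annihilated phi ->
    {in D, forall k, phi (rep k) = 0} -> forall s, phi s = 0.
Proof.
have [u uf u_max] := leading_exponent f_poly f_neq0 f_deg.
have [rep repP] := minimal_representatives.
(* The first two conditions discard labels whose representative is a default value; the third says
   that X^u does not divide X^(rep k). *)
pose D := [set k | [&& lab (rep k) == k, [forall i, 0 <= rep k 0 i]
                     & [exists i, rep k 0 i < u 0 i]]].
exists D, rep; split.
  apply: (@leq_trans ((\sum_i `|u 0%R i|) * (r * n ^ m.-1))).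
    apply: card_label_box => k; rewrite inE => /and3P[/eqP repk /forallP rep0].
    case/existsP => i lt_u; exists i.
    have lt_abs : (`|rep k 0%R i| < `|u 0%R i|)%N.
      by rewrite -ltz_nat !gez0_abs ?(ltW (le_lt_trans _ lt_u)).
    have repE : (lab (rep k)).1 i = ord_mod n_gt0 (rep k 0 i) by rewrite ffunE.
    by exists (Ordinal lt_abs); rewrite /= gez0_abs // -repE repk.
  by rewrite mulnCA mulnA leq_mul2r (leq_mul2l r) (ore_support_deg f_poly f_deg uf) !orbT.
move=> phi phi_per phi_ann phi_rep.
have phi_lab s t : lab s = lab t -> phi s = phi t.
  by move=> /label_eq[l ->]; apply: phi_per.
have phi_nonneg : forall N s, (weight c.+1 s < N)%N -> nonneg_row s -> phi s = 0.
  elim=> // N IHN s sN s0; have [t0 ts wt_s] := repP s s0.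
  set t := rep (lab s) in t0 ts wt_s; rewrite -(phi_lab _ _ ts).
  have [tD|tD] := boolP (lab s \in D); first exact: phi_rep.
  have ut i : u 0 i <= t 0 i.
    rewrite leNgt; apply/negP => tu; case/negP: tD; rewrite inE ts eqxx /=.
    by apply/andP; split; [apply/forallP|apply/existsP; exists i].
  have v0 : nonneg_row (t - u) by move=> i; rewrite !mxE subr_ge0.
  (* The term w = u is phi t times a Frobenius twist of [f@_u], which is nonzero; all other terms
     have weight below that of t. *)
  have /eqP := phi_ann (t - u); rewrite (bigD1_seq u) ?fset_uniq //= subrK.
  rewrite big_seq_cond big1 => [|w /andP[wf wu]].
    rewrite addr0 mulf_eq0 => /orP[|/eqP//].
    rewrite -(linear0 (frobz E (edot e (t - u)))) (inj_eq (@frobz_inj _ _ _)).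
    by rewrite (negPf (_ : f@_u != 0)) // mcoeff_neq0.
  have u0 := ore_support_nonneg f_poly uf; have w0 := ore_support_nonneg f_poly wf.
  rewrite (IHN (t - u + w)) ?mulr0 //; last first.
    by move=> i; rewrite mxE addr_ge0.
  rewrite (weightD _ v0 w0); apply: (@leq_trans (weight c.+1 (t - u + u))).
    by rewrite (weightD _ v0 u0) ltn_add2l u_max.
  by rewrite subrK (leq_trans wt_s).
(* Adding n r |s_i| to each entry moves any s into the nonnegative orthant without leaving its
   class. *)
move=> s; pose z : 'rV[int]_m := \row_i `|s 0 i|.
have zr : r%:Z *: z \in in_lattice e r.
  by rewrite -[_ \in _]/(r%:Z %| edot e (r%:Z *: z))%Z edotZ dvdz_mulr.
rewrite -(phi_per (Lattice zr)); apply: (phi_nonneg _.+1) => // i.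
rewrite !mxE /= mulrA -PoszM; have nr0 : (0 < n * r)%N by rewrite muln_gt0 n_gt0.
rewrite -lerBlDr sub0r (le_trans (ler_norm _)) // normrN.
by rewrite -[X in X <= _]mul1r ler_wpM2r.
Qed.

End Vanishing.

(** * Functions on exponents attached to kernel vectors *)

Section Orbits.
Variables (F : finFieldType) (E : fieldExtType F) (m r : nat).
Variables (e : 'rV[int]_m) (f : ore_laurent E e).
Hypothesis dimE : \dim {:E} = r.

(** This is the image of x under the evaluation of the monomial X^s. *)
Definition orbit_fun (gt : 'rV[int]_m -> E) (x : E) (s : 'rV[int]_m) : E :=
  gt s * frobz E (edot e s) x.

Section OneCharacter.
Variables (g : lattice e r -> {unit F}) (gt : 'rV[int]_m -> E).
Hypotheses (gM : lattice_chars F e r g) (gtP : cocycle_extension g gt).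

Lemma orbit_funD x v w :
  orbit_fun gt x (v + w) = gt v * frobz E (edot e v) (orbit_fun gt x w).
Proof.
have [_ _ gtD] := gtP.
by rewrite /orbit_fun gtD edotD frobzD frobzM mulrA.
Qed.

(** On L the exponent e.l is a multiple of r, so the Frobenius twist is trivial and only the
    character remains. *)
Lemma orbit_fun_lattice x (l : lattice e r) w :
  orbit_fun gt x (val l + w) = (val (g l))%:A * orbit_fun gt x w.
Proof.
have [_ gtg _] := gtP; rewrite orbit_funD gtg; congr (_ * _).
have /dvdzP[k ->] : (r%:Z %| edot e (val l))%Z := valP l.
by rewrite mulrC -dimE frobz_dim.
Qed.

(** The values of g lie in a group of order q - 1, so g is trivial on (q - 1) L. *)
Lemma orbit_fun_periodic x : lattice_periodic #|F|.-1 r e (orbit_fun gt x).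
Proof.
move=> l s; have gX k : g (l *+ k) = (g l ^+ k)%g.
  elim: k => [|k IHk]; last by rewrite mulrS expgS gM IHk.
  by apply: (mulgI (g 0)); rewrite -gM addr0 mulg1.
have -> : #|F|.-1%:Z *: val l = val (l *+ #|F|.-1).
  by rewrite raddfMn -scaler_nat natz.
rewrite orbit_fun_lattice gX -card_finField_unit expg_cardG ?inE //.
by rewrite scale1r mul1r.
Qed.

(** Apply the evaluation of X^v to the equation f(x) = 0. *)
Lemma orbit_fun_annihilated x : x \in lker (ore_eval gt f) ->
  ore_annihilated f (orbit_fun gt x).
Proof.
rewrite memv_ker /ore_eval sum_lfunE => /eqP fx0 v.
transitivity (gt v * frobz E (edot e v)
    (\sum_(w <- msupp f) f@_w * orbit_fun gt x w)).
  rewrite linear_sum mulr_sumr; apply: eq_bigr => w _.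
  by rewrite orbit_funD [X in _ = _ * X]frobzM mulrCA.
rewrite (_ : \sum_(w <- _) _ = 0) ?linear0 ?mulr0 // -[RHS]fx0.
by apply: eq_bigr => w _; rewrite comp_lfunE lfunE /= /orbit_fun mulrA.
Qed.

End OneCharacter.

Lemma orbit_fun_free (k : nat) (g : 'I_k -> lattice e r -> {unit F})
    (gt : 'I_k -> 'rV[int]_m -> E) (X : 'I_k -> seq E)
    (gM : forall i, lattice_chars F e r (g i))
    (gtP : forall i, cocycle_extension (g i) (gt i)) (g_inj : injective g)
    (e_r : gcdn (\big[gcdn/0%N]_(i < m) `|e 0%R i|%N) r = 1%N)
    (X_free : forall i, free (X i)) (b : 'I_k -> nat -> E) :
  (forall s, \sum_i \sum_(j < size (X i)) b i j * orbit_fun (gt i) (X i)`_j s = 0) ->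
  forall i (j : 'I_(size (X i))), b i j = 0.
Proof.
move=> sum0 i j.
pose chi i (l : lattice e r) : E := (val (g i l))%:A.
(* Translating s by l in L multiplies the i-th inner sum by [chi i l], so Artin's lemma kills each
   inner sum. *)
have sum0i s : \sum_(j < size (X i)) b i j * orbit_fun (gt i) (X i)`_j s = 0.
  apply: (@characters_free _ +%R (0 : lattice e r) _ _ chi _ _ _ (index_enum _)
    (fun i => \sum_(j < size (X i)) b i j * orbit_fun (gt i) (X i)`_j s)).
  - by move=> i' l l'; rewrite /chi gM -[LHS]/(in_alg E (val _ * val _)) rmorphM.
  - by move=> i' l; rewrite /chi scaler_eq0 oner_eq0 orbF -unitfE (valP (g i' l)).
  - move=> i1 i2 eq_chi; apply: g_inj; apply/funext => l; apply: val_inj.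
    exact: (fmorph_inj (in_alg E) (eq_chi l)).
  - exact: index_enum_uniq.
  - move=> l; rewrite -[RHS](sum0 (val l + s)); apply: eq_bigr => i' _.
    rewrite mulr_suml; apply: eq_bigr => j' _.
    by rewrite (orbit_fun_lattice (gtP i')) -mulrA [_ * chi _ _]mulrC.
  exact: mem_index_enum.
(* For each power of Frobenius [edot_surj] gives a suitable s, and the nonzero factor [gt i s]
   cancels. *)
apply: (moore_free (X_free i)) (ltn_ord j) => q.
have [s sq] := edot_surj e_r q; have [gt0 _ _] := gtP i.
apply: (mulfI (gt0 s)); rewrite mulr0 -[RHS](sum0i s) mulr_sumr.
apply: eq_bigr => j' _; rewrite mulrCA /orbit_fun.
by rewrite (@frobz_eqmod _ _ (edot e s) q) // dimE.
Qed.

End Orbits.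

Theorem theorem3p5 (F : finFieldType) (E : fieldExtType F) (r m c : nat)
    (dimE : \dim {:E} = r) (m_gt0 : (0 < m)%N)
    (e : 'rV[int]_m)
    (gcd_e : gcdn (\big[gcdn/0%N]_(i < m) `|e 0%R i|%N) r = 1%N)
    (gt : (lattice e r -> {unit F}) -> 'rV[int]_m -> E)
    (gtP : forall g, lattice_chars F e r g -> cocycle_extension g (gt g))
    (f : ore_laurent E e)
    (f_poly : f \in ore_poly E e) (f_neq0 : f != 0)
    (f_deg : (ore_tdeg f <= c)%N) :
  (\big[addn/0%N]_(g \in lattice_chars F e r) \dim (lker (ore_eval (gt g) f))
     <= r * c * #|F|.-1 ^ m.-1)%N.
Proof.
have r_gt0 : (0 < r)%N by rewrite -dimE adim_gt0.
have n_gt0 : (0 < #|F|.-1)%N by rewrite -subn1 subn_gt0 finNzRing_gt1.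
have fin_chars := lattice_chars_finite F e r_gt0.
rewrite fsbig_finite //; set H : seq _ := fset_set _.
pose g i := tnth (in_tuple H) i; pose U i := lker (ore_eval (gt (g i)) f).
have gM i : lattice_chars F e r (g i).
  by have := mem_tnth i (in_tuple H); rewrite in_fset_set // => /set_mem.
have g_inj : injective g by apply/tuple_uniqP; apply: fset_uniq.
have [D [rep [D_le phi_eq0]]] :=
  ore_annihilated_eq0 n_gt0 r_gt0 f_poly f_neq0 f_deg.
apply: leq_trans D_le.
(* One index for each vector of an F-basis of each kernel. *)
pose I : finType := {i : 'I_(size H) & 'I_(size (vbasis (U i)))}.
have -> : (\sum_(h <- H) \dim (lker (ore_eval (gt h) f)))%N = #|I|.
  rewrite card_tagged sumnE big_map big_enum big_tnth.
  by apply: eq_bigr => i _; rewrite card_ord size_tuple.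
pose psi (p : I) := orbit_fun e (gt (g (tag p))) (vbasis (U (tag p)))`_(tagged p).
apply: (free_card_le (psi := fun p k => psi p (rep k))) => b b0 [i j].
pose b' i (j : nat) : E := oapp (fun j' => b (existT _ i j')) 0 (insub j).
have b'E i' (j' : 'I_(size (vbasis (U i')))) : b' i' j' = b (existT _ i' j').
  by rewrite /b' valK.
have gtgP i' := gtP _ (gM i').
have U_free i' : free (vbasis (U i')) := basis_free (vbasisP _).
rewrite -b'E; apply: (orbit_fun_free dimE gM gtgP g_inj gcd_e U_free) => s.
transitivity (\sum_p b p * psi p s).
  rewrite sum_sigT; apply: eq_bigr => i' _; apply: eq_bigr => j' _.
  by rewrite b'E.
(* Periodicity and the recurrence are E-linear in phi, so they pass to the combination with
   coefficients b. *)
apply: (phi_eq0 (fun s => \sum_p b p * psi p s)) => // [l t|v].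
  by apply: eq_bigr => p _; rewrite /psi (orbit_fun_periodic dimE (gM _) (gtgP _)).
under eq_bigr => w _ do rewrite mulr_sumr.
rewrite exchange_big big1 //= => p _; under eq_bigr => w _ do rewrite mulrCA.
rewrite -mulr_sumr (orbit_fun_annihilated (gtgP _)) ?mulr0 //.
by rewrite vbasis_mem // mem_nth.
Qed.
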